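(* There exists a universal constant $C_1<\infty$ such that the following holds. Suppose that $y:\mathbb{R}\times(0,T)\to(0,\infty)$ is a positive (smooth) solution of graphical curve shortening flow $y_t=\frac{y_{xx}}{1+y_x^2}$. Then for all $t\in(0,T)$ and all $x\in\mathbb{R}$, we have $$|y_x|\leq C_1\left(\frac{y^2}{t}\right)^{1/2}\exp\left[\frac{y^2}{4t}\right]+C_1$$ at $(x,t)$.
   Context: ''Universal'' means that $C_1$ does not depend on $y$, $T$, $x$ or $t$. *)

(* Defs.v *)
From Stdlib Require Import Reals.
From Coquelicot Require Import Coquelicot.
Open Scope R_scope.

(* A function on the strip is a total function [y : R -> R -> R], space variable
   first; only its values at times in the open interval (0, T) matter, since
   every notion below is local in [t].
   [ex_diff_n y n x t]: all iterated partial derivatives of [y] of total order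
   at most [n], in any order of differentiation, exist at [(x, t)] and are
   jointly continuous there.  Required at every point of the open strip and for
   every [n], this is C^infinity smoothness. *)
Definition smooth_on_strip (T : R) (y : R -> R -> R) : Prop :=
  forall x t : R, 0 < t < T -> forall n : nat, ex_diff_n y n x t.

Definition graphical_csf (T : R) (y : R -> R -> R) : Prop :=
  smooth_on_strip T y /\
  forall x t : R, 0 < t < T ->
    partial_derive 0 1 y x t =
    partial_derive 2 0 y x t / (1 + (partial_derive 1 0 y x t) ^ 2).

(* Main.v *)
Require Import Defs.
From Stdlib Require Import Reals Lra Classical ClassicalEpsilon List.
From Coquelicot Require Import Coquelicot.
Open Scope R_scope.

(** Read horizontally, a graph [x = E(v,t)] moving by curve shortening that starts
    from the half-line [x = 0, v > 0] and decays like [exp (-v^2/4t)] should cross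
    every positive solution [y] at most once, so that [x - E(y(x,t),t)] is
    nondecreasing in [x]; this says [y_x <= 1 / E_v(y,t)], which is the estimate.
    No exact expander is needed: it suffices that [E = sqrt t * profile (v / sqrt t)]
    is bounded, increasing in [v], tends to [0] with [t], and that
    [E_vv / (1 + E_v^2) - E_t] is nondecreasing in [v].  Monotonicity of
    [x - E(y(x,t),t)] then follows from a maximum principle for the two-point
    function [(x2 - x1) - (E(y(x2,t),t) - E(y(x1,t),t))].  Since [E] is bounded,
    this function is positive once [x2 - x1] is large, so that no growth condition on
    [y] is needed.  As [y] is only defined for [t > 0], the clock of [E] is started at
    a time [t0 > 0] and [t0] tends to [0] at the end. *)

(** * The barrier profile and its derivatives *)

Definition gauss (s : R) : R := exp (- (s ^ 2 / 4)).

(** The derivative of [profile] divided by [amp * gauss s]. Writing [s] as [(1 + s) - 1] leaves only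
    inverse powers of [1 + s], and the cubic ones cancel. [slope_weight1] and [slope_weight2] are
    its derivatives. *)
Definition slope_weight (s : R) : R :=
  / 2 * / (1 + s) + 3 / 2 * / (1 + s) ^ 2 + 12 * / (1 + s) ^ 4.

Definition slope_weight1 (s : R) : R :=
  - (/ 2 * / (1 + s) ^ 2 + 3 * / (1 + s) ^ 3 + 48 * / (1 + s) ^ 5).

Definition slope_weight2 (s : R) : R :=
  / (1 + s) ^ 3 + 9 * / (1 + s) ^ 4 + 240 * / (1 + s) ^ 6.

(* Small enough for the terms cubic in the amplitude to be absorbed in
   [defect_derivative_pos]. *)
Definition amp : R := / 100000.

(* The weight [r^-2 + 4 r^-3], [r = 1 + s], imitates the decay [exp (-s^2/4) / s^2]
   of the true expander profile; the coefficient 4 makes the linearised [defect]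
   equal to [- amp * gauss s * (r^-3 + 48 r^-5)], hence increasing. *)
Definition profile (s : R) : R :=
  - amp * gauss s * (/ (1 + s) ^ 2 + 4 * / (1 + s) ^ 3).

Definition profile1 (s : R) : R := amp * gauss s * slope_weight s.

Definition profile2 (s : R) : R :=
  amp * gauss s * (slope_weight1 s - s * slope_weight s / 2).

Definition profile3 (s : R) : R :=
  amp * gauss s *
  (slope_weight2 s - s * slope_weight1 s - slope_weight s / 2
   + s ^ 2 * slope_weight s / 4).

(* With [E(v,t) = sqrt t * profile (v / sqrt t)], this is
   [sqrt t * (E_vv / (1 + E_v^2) - E_t)]; it would vanish for an exact expander. *)
Definition defect (s : R) : R :=
  profile2 s / (1 + profile1 s ^ 2) + (s * profile1 s - profile s) / 2.

Lemma is_derive_gauss (s : R) : is_derive gauss s (- (s / 2) * gauss s).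
Proof. unfold gauss, Rdiv. auto_derive; [easy|]. simpl. field. Qed.

Lemma is_derive_slope_weight (s : R) :
  0 <= s -> is_derive slope_weight s (slope_weight1 s).
Proof.
intros hs. unfold slope_weight, slope_weight1. auto_derive.
- repeat split; try apply Rmult_integral_contrapositive_currified;
  try apply pow_nonzero; nra.
- field. lra.
Qed.

Lemma is_derive_slope_weight1 (s : R) :
  0 <= s -> is_derive slope_weight1 s (slope_weight2 s).
Proof.
intros hs. unfold slope_weight1, slope_weight2. auto_derive.
- repeat split; try apply Rmult_integral_contrapositive_currified;
  try apply pow_nonzero; try nra.
- field. lra.
Qed.

Lemma is_derive_profile (s : R) :
  0 <= s -> is_derive profile s (profile1 s).
Proof.
intros hs. unfold profile, profile1, slope_weight. auto_derive.
- repeat split; try (eexists; apply is_derive_gauss);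
  try apply Rmult_integral_contrapositive_currified;
  try apply pow_nonzero; try nra.
- change (fun x => gauss x) with gauss.
  rewrite (is_derive_unique _ _ _ (is_derive_gauss s)). field. lra.
Qed.

Lemma is_derive_profile1 (s : R) :
  0 <= s -> is_derive profile1 s (profile2 s).
Proof.
intros hs. unfold profile1, profile2. auto_derive.
- split; [eexists; apply is_derive_gauss|].
  split; [eexists; apply is_derive_slope_weight; lra|easy].
- change (fun x => gauss x) with gauss.
  change (fun x => slope_weight x) with slope_weight.
  rewrite (is_derive_unique _ _ _ (is_derive_gauss s)).
  rewrite (is_derive_unique _ _ _ (is_derive_slope_weight s hs)). field.
Qed.

Lemma is_derive_profile2 (s : R) :
  0 <= s -> is_derive profile2 s (profile3 s).
Proof.
intros hs. unfold profile2, profile3. auto_derive.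
- split; [eexists; apply is_derive_gauss|].
  split; [eexists; apply is_derive_slope_weight1; lra|].
  split; [eexists; apply is_derive_slope_weight; lra|easy].
- change (fun x => gauss x) with gauss.
  change (fun x => slope_weight x) with slope_weight.
  change (fun x => slope_weight1 x) with slope_weight1.
  rewrite (is_derive_unique _ _ _ (is_derive_gauss s)).
  rewrite (is_derive_unique _ _ _ (is_derive_slope_weight1 s hs)).
  rewrite (is_derive_unique _ _ _ (is_derive_slope_weight s hs)). field.
Qed.

(** * Pointwise bounds on the profile *)

Lemma gauss_pos (s : R) : 0 < gauss s.
Proof. apply exp_pos. Qed.

Lemma gauss_le_1 (s : R) : gauss s <= 1.
Proof.
rewrite <- exp_0. unfold gauss.
destruct (Req_dec s 0) as [->|h].
- right. f_equal. field.
- left. apply exp_increasing. nra.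
Qed.

(** With [e = exp (s^2/6)], [gauss s ^ 2 = e^-3], and [1 + s^2/6 <= e] gives [(1 + s)^2 <= 12 e].
    Cubing yields [1728 = 12^3]. *)
Lemma gauss_sq_decay (s : R) : 0 <= s -> gauss s ^ 2 * (1 + s) ^ 6 <= 1728.
Proof.
intros hs.
assert (h1 : gauss s ^ 2 * exp (s ^ 2 / 6) ^ 3 = 1).
{ unfold gauss. simpl. rewrite !Rmult_1_r, <- !exp_plus, <- exp_0.
  f_equal. field. }
assert (h2 : 1 + s ^ 2 / 6 <= exp (s ^ 2 / 6)).
{ destruct (Req_dec (s ^ 2 / 6) 0) as [->|h].
  - rewrite exp_0. lra.
  - left. now apply exp_ineq1. }
assert (h3 : (1 + s) ^ 2 <= 12 * exp (s ^ 2 / 6)) by nra.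
assert (h4 : (1 + s) ^ 6 <= 1728 * exp (s ^ 2 / 6) ^ 3).
{ replace ((1 + s) ^ 6) with (((1 + s) ^ 2) ^ 3) by ring.
  replace (1728 * exp (s ^ 2 / 6) ^ 3) with ((12 * exp (s ^ 2 / 6)) ^ 3) by ring.
  apply pow_incr. split; [apply pow2_ge_0 | easy]. }
assert (h5 : 0 < gauss s ^ 2) by (apply pow_lt, gauss_pos).
replace 1728 with (gauss s ^ 2 * (1728 * exp (s ^ 2 / 6) ^ 3)).
- apply Rmult_le_compat_l; lra.
- transitivity (1728 * (gauss s ^ 2 * exp (s ^ 2 / 6) ^ 3)); [ring|].
  rewrite h1. ring.
Qed.

Lemma inv_pow_bounds (s : R) (n : nat) : 0 <= s -> 0 < / (1 + s) ^ n <= 1.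
Proof.
intros hs. split.
- apply Rinv_0_lt_compat, pow_lt. lra.
- rewrite <- Rinv_1. apply Rinv_le_contravar; [lra|]. apply pow_R1_Rle. lra.
Qed.

Lemma slope_weight_lower (s : R) : 0 <= s -> / 2 * / (1 + s) <= slope_weight s.
Proof.
intros hs. unfold slope_weight.
pose proof (inv_pow_bounds s 2 hs). pose proof (inv_pow_bounds s 4 hs). lra.
Qed.

(** After multiplication by [1 + s], each inverse power is at most 1, so the coefficients add up to
    [1/2 + 3/2 + 12 = 14]. *)
Lemma slope_weight_bounds (s : R) :
  0 <= s -> 0 < slope_weight s /\ (1 + s) * slope_weight s <= 14.
Proof.
intros hs. split.
- eapply Rlt_le_trans; [|now apply slope_weight_lower].
  apply Rmult_lt_0_compat; [lra|]. apply Rinv_0_lt_compat. lra.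
- replace ((1 + s) * slope_weight s)
    with (/ 2 + 3 / 2 * / (1 + s) ^ 1 + 12 * / (1 + s) ^ 3)
    by (unfold slope_weight; field; lra).
  pose proof (inv_pow_bounds s 1 hs). pose proof (inv_pow_bounds s 3 hs). lra.
Qed.

Lemma profile_bounds (s : R) : 0 <= s -> - 1 <= profile s <= 0.
Proof.
intros hs. unfold profile, amp.
pose proof (gauss_pos s). pose proof (gauss_le_1 s).
pose proof (inv_pow_bounds s 2 hs). pose proof (inv_pow_bounds s 3 hs).
set (a := / (1 + s) ^ 2) in *. set (b := / (1 + s) ^ 3) in *.
split; nra.
Qed.

Lemma profile1_bounds (s : R) :
  0 <= s -> 0 < profile1 s <= 14 * (amp * gauss s).
Proof.
intros hs. destruct (slope_weight_bounds s hs) as [h1 h2].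
pose proof (gauss_pos s). assert (0 < amp) by (unfold amp; lra).
assert (0 < amp * gauss s) by now apply Rmult_lt_0_compat.
unfold profile1. split; nra.
Qed.

Lemma profile2_bounds (s : R) :
  0 <= s -> Rabs (profile2 s) <= 60 * (amp * gauss s).
Proof.
intros hs. destruct (slope_weight_bounds s hs) as [h1 h2].
pose proof (gauss_pos s). assert (0 < amp) by (unfold amp; lra).
assert (0 < amp * gauss s) by now apply Rmult_lt_0_compat.
assert (- 52 <= slope_weight1 s <= 0).
{ unfold slope_weight1. pose proof (inv_pow_bounds s 2 hs).
  pose proof (inv_pow_bounds s 3 hs). pose proof (inv_pow_bounds s 5 hs). lra. }
unfold profile2. apply Rabs_le.
assert (0 <= s * slope_weight s <= 14) by nra.
split; nra.
Qed.

(** * Monotonicity of the defect *)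

(** The right-hand side is the derivative of the linearised defect
    [- amp * gauss s * (r^-3 + 48 r^-5)], [r = 1 + s]. All its terms are nonnegative, and only
    [3 r^-4] is kept. *)
Lemma profile3_lower (s : R) :
  0 <= s ->
  3 * / (1 + s) ^ 4 * (amp * gauss s) <= profile3 s + s / 2 * profile2 s.
Proof.
intros hs.
pose proof (gauss_pos s). assert (0 < amp) by (unfold amp; lra).
assert (0 < amp * gauss s) by now apply Rmult_lt_0_compat.
replace (profile3 s + s / 2 * profile2 s) with
  (amp * gauss s * (3 * / (1 + s) ^ 4 + 240 * / (1 + s) ^ 6
     + s / 2 * (/ (1 + s) ^ 3 + 48 * / (1 + s) ^ 5))).
- rewrite (Rmult_comm _ (amp * gauss s)). apply Rmult_le_compat_l; [lra|].
  pose proof (inv_pow_bounds s 6 hs). pose proof (inv_pow_bounds s 3 hs).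
  pose proof (inv_pow_bounds s 5 hs). nra.
- unfold profile3, profile2, slope_weight2, slope_weight1, slope_weight.
  field. lra.
Qed.

Lemma is_derive_defect (s : R) :
  0 <= s ->
  is_derive defect s
    ((profile3 s + s / 2 * profile2 s * (1 + profile1 s ^ 2)
      - 2 * profile1 s * profile2 s ^ 2 / (1 + profile1 s ^ 2))
     / (1 + profile1 s ^ 2)).
Proof.
intros hs. unfold defect. auto_derive.
- split; [now exists (profile3 s); apply is_derive_profile2|].
  split; [now exists (profile2 s); apply is_derive_profile1|].
  split; [nra|].
  split; [now exists (profile2 s); apply is_derive_profile1|].
  split; [now exists (profile1 s); apply is_derive_profile|easy].
- change (fun x => profile x) with profile.
  change (fun x => profile1 x) with profile1.
  change (fun x => profile2 x) with profile2.
  rewrite (is_derive_unique _ _ _ (is_derive_profile s hs)).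
  rewrite (is_derive_unique _ _ _ (is_derive_profile1 s hs)).
  rewrite (is_derive_unique _ _ _ (is_derive_profile2 s hs)). field. nra.
Qed.

(** The linear part is at least [3 A / (1 + s)^4] with [A = amp * gauss s]. The remaining terms are
    of order [A^3]; the smallness of [amp] and the Gaussian decay make them smaller than that. *)
Lemma defect_derivative_pos (s : R) :
  0 <= s ->
  0 < profile3 s + s / 2 * profile2 s * (1 + profile1 s ^ 2)
      - 2 * profile1 s * profile2 s ^ 2 / (1 + profile1 s ^ 2).
Proof.
intros hs.
pose proof (profile1_bounds s hs) as [h1 h1'].
pose proof (profile2_bounds s hs) as h2.
pose proof (profile3_lower s hs) as h3.
pose proof (gauss_pos s) as hg. pose proof (gauss_sq_decay s hs) as hd.
assert (ha : 0 < amp) by (unfold amp; lra).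
set (A := amp * gauss s) in *.
assert (hA : 0 < A) by now apply Rmult_lt_0_compat.
assert (hq : profile1 s ^ 2 <= 196 * A ^ 2) by nra.
assert (hp : profile2 s ^ 2 <= 3600 * A ^ 2).
{ rewrite <- pow2_abs. pose proof (Rabs_pos (profile2 s)). nra. }
assert (hc : - (s * 5880 * A ^ 3) <= s / 2 * profile2 s * profile1 s ^ 2).
{ apply Rabs_le_between in h2. pose proof (pow2_ge_0 (profile1 s)).
  assert (- (60 * A) * (196 * A ^ 2) <= profile2 s * profile1 s ^ 2) by nra.
  nra. }
assert (hb : 2 * profile1 s * profile2 s ^ 2 / (1 + profile1 s ^ 2)
             <= 100800 * A ^ 3).
{ apply Rle_trans with (2 * profile1 s * profile2 s ^ 2).
  - apply Rle_div_l; [nra|]. pose proof (pow2_ge_0 (profile2 s)).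
    assert (0 <= 2 * profile1 s * profile2 s ^ 2) by nra.
    pose proof (pow2_ge_0 (profile1 s)). nra.
  - pose proof (pow2_ge_0 (profile2 s)). nra. }
(* The constant [100800 = 2 * 14 * 3600] of [hb] also dominates the [5880 = 60 * 196 / 2] of [hc],
   so both errors together cost at most one of the three units of [A / (1 + s)^4]. *)
assert (hk : 100800 * (1 + s) * A ^ 2 <= 1 * / (1 + s) ^ 4).
{ apply (Rmult_le_reg_r ((1 + s) ^ 4)); [apply pow_lt; lra|].
  replace (1 * / (1 + s) ^ 4 * (1 + s) ^ 4) with 1 by (field; lra).
  assert (A ^ 2 * (1 + s) ^ 6 <= 1728 / 10000000000).
  { unfold A. replace ((amp * gauss s) ^ 2 * (1 + s) ^ 6)
      with (amp ^ 2 * (gauss s ^ 2 * (1 + s) ^ 6)) by ring.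
    unfold amp. lra. }
  assert (A ^ 2 * (1 + s) ^ 5 <= A ^ 2 * (1 + s) ^ 6).
  { apply Rmult_le_compat_l; [apply pow2_ge_0|]. apply Rle_pow; [lra|auto]. }
  replace (100800 * (1 + s) * A ^ 2 * (1 + s) ^ 4)
    with (100800 * (A ^ 2 * (1 + s) ^ 5)) by ring.
  lra. }
pose proof (inv_pow_bounds s 4 hs) as hi.
set (i4 := / (1 + s) ^ 4) in *.
assert (A * (100800 * (1 + s) * A ^ 2) <= A * i4) by nra.
assert (0 < A * i4) by now apply Rmult_lt_0_compat.
assert (0 <= s * A ^ 3) by (apply Rmult_le_pos; [lra|apply pow_le; lra]).
nra.
Qed.

Lemma increasing_of_derive_nonneg (f df : R -> R) (a b : R) :
  a <= b ->
  (forall z, a <= z <= b -> is_derive f z (df z) /\ 0 <= df z) ->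
  f a <= f b.
Proof.
intros hab h.
destruct (Rle_lt_or_eq_dec a b hab) as [hlt| ->]; [|lra].
destruct (MVT_cor2 f df a b hlt) as [c [e hc]].
- intros z hz. now apply is_derive_Reals, h.
- pose proof (proj2 (h c ltac:(lra))). nra.
Qed.

Lemma defect_increasing (s r : R) : 0 <= s -> s <= r -> defect s <= defect r.
Proof.
intros hs hr. eapply increasing_of_derive_nonneg; [easy|].
intros z hz. split; [apply is_derive_defect; lra|].
apply Rlt_le, Rdiv_lt_0_compat; [apply defect_derivative_pos; lra|nra].
Qed.

Lemma profile_increasing (s r : R) : 0 <= s -> s <= r -> profile s <= profile r.
Proof.
intros hs hr. eapply increasing_of_derive_nonneg; [easy|].
intros z hz. split; [apply is_derive_profile; lra|].
apply Rlt_le, profile1_bounds. lra.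
Qed.

(** * Minimum of a continuous function on a box *)

Lemma list_argmin {A : Type} (g : A -> R) (l : list A) :
  l <> nil -> exists p, In p l /\ forall q, In q l -> g p <= g q.
Proof.
induction l as [|a l IH]; [congruence|]. intros _.
destruct l as [|b l].
- exists a. split; [now left|]. intros q [->|[]]. lra.
- destruct IH as [p [hp h]]; [congruence|].
  destruct (Rle_lt_dec (g a) (g p)) as [hap|hpa].
  + exists a. split; [now left|]. intros q [->|hq]; [lra|].
    specialize (h q hq). lra.
  + exists p. split; [now right|]. intros q [<-|hq]; [lra|]. now apply h.
Qed.

(* If no point is minimal, each [p] has a neighbourhood on which [f] exceeds
   [f (next p)]; a finite subcover contradicts the least of these values. *)
Lemma box_attains_min (f : R * (R * R) -> R) (a1 b1 a2 b2 a3 b3 : R) :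
  a1 <= b1 -> a2 <= b2 -> a3 <= b3 ->
  (forall u v w, a1 <= u <= b1 -> a2 <= v <= b2 -> a3 <= w <= b3 ->
     continuous f (u, (v, w))) ->
  exists u v w, a1 <= u <= b1 /\ a2 <= v <= b2 /\ a3 <= w <= b3 /\
    forall u' v' w', a1 <= u' <= b1 -> a2 <= v' <= b2 -> a3 <= w' <= b3 ->
      f (u, (v, w)) <= f (u', (v', w')).
Proof.
intros h1 h2 h3 hf.
apply NNPP. intros hno.
set (P := fun (p : Compactness.Tn 3 R) =>
  let '(u, (v, (w, _))) := p in
  a1 <= u <= b1 /\ a2 <= v <= b2 /\ a3 <= w <= b3).
set (F := fun (p : Compactness.Tn 3 R) =>
  let '(u, (v, (w, _))) := p in f (u, (v, w))).
assert (step : forall p, exists q, P p -> P q /\ F q < F p).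
{ intros p. destruct (classic (exists q, P q /\ F q < F p)) as [[q hq]|hq].
  - exists q. tauto.
  - exists p. intros hp. exfalso. apply hno.
    destruct p as [u [v [w []]]]. destruct hp as [hu [hv hw]].
    exists u, v, w. repeat split; try tauto.
    intros u' v' w' hu' hv' hw'. apply Rnot_lt_le. intros hlt. apply hq.
    exists (u', (v', (w', tt))). now repeat split. }
destruct (choice _ step) as [next hnext].
assert (nbhd : forall p, exists d : posreal, P p -> forall q,
  close_n 3 d q p -> F (next p) < F q).
{ intros p. destruct (classic (P p)) as [hp|hp].
  2: { exists (mkposreal 1 Rlt_0_1). tauto. }
  destruct (hnext p hp) as [_ hlt].
  destruct p as [u [v [w []]]]. destruct hp as [hu [hv hw]].
  assert (hl : locally (u, (v, w)) (fun z => F (next (u, (v, (w, tt)))) < f z)).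
  { apply (hf u v w hu hv hw (fun r => F (next (u, (v, (w, tt)))) < r)).
    now apply (open_gt (F (next (u, (v, (w, tt)))))). }
  destruct hl as [d hd]. exists d. intros _ [u' [v' [w' []]]] [cu [cv [cw _]]].
  apply (hd (u', (v', w'))). now repeat split. }
destruct (choice _ nbhd) as [delta hdelta].
(* The finite subcover comes under a double negation, which suffices since the goal is [False]. *)
apply (compactness_list 3 (a1, (a2, (a3, tt))) (b1, (b2, (b3, tt))) delta).
intros [l hl].
assert (hP : forall p, bounded_n 3 (a1, (a2, (a3, tt))) (b1, (b2, (b3, tt))) p
  <-> P p).
{ intros [u [v [w []]]]. unfold P. simpl. tauto. }
(* Centres outside the box carry no information on [F (next p)], so they are filtered out before the
   least value is taken. *)
assert (cover : forall x, P x -> exists p, In p (filter (fun p =>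
   if excluded_middle_informative (P p) then true else false) l) /\
   F (next p) < F x).
{ intros x hx. destruct (hl x (proj2 (hP x) hx)) as [p [hp [hb hc]]].
  exists p. apply hP in hb. split.
  - apply filter_In. split; [easy|].
    now destruct (excluded_middle_informative (P p)).
  - now apply (hdelta p hb). }
destruct (list_argmin (fun p => F (next p)) (filter (fun p =>
   if excluded_middle_informative (P p) then true else false) l))
  as [p [hp hmin]].
- intros hnil. destruct (cover (a1, (a2, (a3, tt)))) as [p [hp _]].
  + unfold P. lra.
  + now rewrite hnil in hp.
- apply filter_In in hp. destruct hp as [_ hp].
  destruct (excluded_middle_informative (P p)) as [hPp|]; [|easy].
  destruct (cover (next p)) as [q [hq hlt]]; [now apply hnext|].
  specialize (hmin q hq). simpl in hmin. lra.
Qed.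

(** * Derivative tests at a minimum *)

Lemma is_derive_reflect (f : R -> R) (a l : R) :
  is_derive f (- a) l -> is_derive (fun z => f (- z)) a (- l).
Proof.
intros hl. replace (- l) with (scal (- 1) l)
  by (unfold scal; simpl; unfold mult; simpl; ring).
apply (is_derive_comp f Ropp); [easy|]. auto_derive; [easy|ring].
Qed.

(** Difference quotients with small negative steps are nonpositive. Only points to the left of [c]
    enter, so the test also applies in time when the minimum occurs at the final time. *)
Lemma derive_nonpos_of_left_min (f : R -> R) (a c l : R) :
  a < c -> is_derive f c l -> (forall z, a <= z <= c -> f c <= f z) -> l <= 0.
Proof.
intros hac hd hmin. apply Rnot_lt_le. intros hl.
apply is_derive_Reals in hd. destruct (hd l hl) as [d hd'].
set (h := Rmin (d / 2) (c - a)).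
assert (h0 : 0 < h) by (apply Rmin_pos; [apply is_pos_div_2|lra]).
assert (hle : h <= c - a) by apply Rmin_r.
assert (hlt : h < d).
{ eapply Rle_lt_trans; [apply Rmin_l|]. pose proof (cond_pos d). lra. }
specialize (hd' (- h) ltac:(lra) ltac:(rewrite Rabs_Ropp, Rabs_pos_eq; lra)).
apply Rabs_lt_between in hd'.
specialize (hmin (c + - h) ltac:(lra)).
assert ((f (c + - h) - f c) / - h <= 0).
{ replace ((f (c + - h) - f c) / - h) with (- ((f (c + - h) - f c) / h))
    by (field; lra).
  assert (0 <= (f (c + - h) - f c) / h) by (apply Rdiv_le_0_compat; lra). lra. }
lra.
Qed.

Lemma derive_zero_of_min (f : R -> R) (a b c l : R) :
  a < c < b -> is_derive f c l -> (forall z, a <= z <= b -> f c <= f z) -> l = 0.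
Proof.
intros hc hd hmin. apply Rle_antisym.
- apply (derive_nonpos_of_left_min f a c); [lra|easy|]. intros z hz. apply hmin. lra.
- enough (- l <= 0) by lra.
  apply (derive_nonpos_of_left_min (fun z => f (- z)) (- b) (- c)); [lra| |].
  + apply is_derive_reflect. now rewrite Ropp_involutive.
  + intros z hz. rewrite Ropp_involutive. apply hmin. lra.
Qed.

(** Since [df c = 0], a negative [l] would make [df] negative just to the right of [c], and the mean
    value theorem would give a value of [f] below the minimum. *)
Lemma second_derive_nonneg_of_min (f df : R -> R) (a b c l : R) :
  a < c < b -> (forall z, a <= z <= b -> is_derive f z (df z)) ->
  is_derive df c l -> (forall z, a <= z <= b -> f c <= f z) -> 0 <= l.
Proof.
intros hc hd hd2 hmin. apply Rnot_lt_le. intros hl.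
assert (h0 : df c = 0).
{ eapply (derive_zero_of_min f a b c); [easy|apply hd; lra|easy]. }
apply is_derive_Reals in hd2. destruct (hd2 (- l) ltac:(lra)) as [d hd'].
set (h := Rmin (d / 2) (b - c)).
assert (hpos : 0 < h) by (apply Rmin_pos; [apply is_pos_div_2|lra]).
assert (hle : h <= b - c) by apply Rmin_r.
assert (hlt : h < d).
{ eapply Rle_lt_trans; [apply Rmin_l|]. pose proof (cond_pos d). lra. }
assert (hneg : forall z, c < z <= c + h -> df z < 0).
{ intros z hz.
  specialize (hd' (z - c) ltac:(lra) ltac:(rewrite Rabs_pos_eq; lra)).
  replace (c + (z - c)) with z in hd' by ring. rewrite h0 in hd'.
  apply Rabs_lt_between in hd'.
  assert (hq : (df z - 0) / (z - c) < 0) by lra.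
  replace (df z) with ((df z - 0) / (z - c) * (z - c)) by (field; lra). nra. }
destruct (MVT_cor2 f df c (c + h) ltac:(lra)) as [z [e hz]].
{ intros z hz. apply is_derive_Reals, hd. lra. }
specialize (hneg z ltac:(lra)). specialize (hmin (c + h) ltac:(lra)). nra.
Qed.

(** * Two-point maximum principle *)

(** A violation at [t2] makes the penalised function [V] negative somewhere. The bound on [H] and
    the growing weight confine its minimum to a box, and the first and second order conditions there
    contradict the assumed inequality on [Ht]. That inequality is therefore required only at pairs
    satisfying the conditions at the right endpoint. *)
Lemma two_point_maximum_principle (H Hx Hxx Ht : R -> R -> R)
    (t1 t2 B L eps : R) :
  t1 <= t2 -> 0 <= L -> 0 <= eps ->
  (forall x t, t1 <= t <= t2 -> Rabs (H x t) <= B) ->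
  (forall x t, t1 <= t <= t2 -> continuity_2d_pt H x t) ->
  (forall x t, t1 <= t <= t2 -> is_derive (fun z => H z t) x (Hx x t)) ->
  (forall x t, t1 <= t <= t2 -> is_derive (fun z => Hx z t) x (Hxx x t)) ->
  (forall x t, t1 <= t <= t2 -> is_derive (fun z => H x z) t (Ht x t)) ->
  (forall x d, 0 <= d -> H (x + d) t1 - H x t1 <= d + eps) ->
  (forall x d t, t1 <= t <= t2 -> 0 < d -> H x t < H (x + d) t ->
     Hx (x + d) t = 1 -> Hxx (x + d) t <= 0 ->
     Ht (x + d) t - Ht x t <= Rmax 0 (- Hxx x t) + L * Rabs (1 - Hx x t)) ->
  forall x d, 0 <= d -> H (x + d) t2 - H x t2 <= d + eps.
Proof.
intros ht hL heps hB hcont hdx hdxx hdt hinit hpde x0 d0 hd0.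
apply Rnot_lt_le. intros hviol.
(* The growth rate must beat 2 from the second derivative of the weight and [L] from the drift; 3
   leaves a strict margin. *)
set (K := 3 + L).
set (weight := fun x t => exp (K * (t - t1)) * (1 + x ^ 2)).
assert (hw : forall x t, 0 < weight x t).
{ intros x t. apply Rmult_lt_0_compat; [apply exp_pos|nra]. }
(* The penalty uses up exactly half of the violation at [(x0, d0, t2)]. *)
set (eta := (H (x0 + d0) t2 - H x0 t2 - d0 - eps) / (2 * weight x0 t2)).
assert (heta : 0 < eta).
{ apply Rdiv_lt_0_compat; [lra|]. specialize (hw x0 t2). lra. }
set (V := fun x d t => d - H (x + d) t + H x t + eps + eta * weight x t).
assert (hV0 : V x0 d0 t2 < 0).
{ unfold V, eta. specialize (hw x0 t2).
  replace ((H (x0 + d0) t2 - H x0 t2 - d0 - eps) / (2 * weight x0 t2) * weight x0 t2)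
    with ((H (x0 + d0) t2 - H x0 t2 - d0 - eps) / 2) by (field; lra). lra. }
assert (hB' : forall x t, t1 <= t <= t2 -> - B <= H x t <= B).
{ intros x t h. now apply Rabs_le_between, hB. }
assert (hB0 : 0 <= B).
{ pose proof (hB' x0 t1 ltac:(lra)). lra. }
(* The box contains [(x0, d0)], while [V] is positive for separation [M] (since [M > 2 * B]) and for
   [Rabs x >= Q] (since the penalty exceeds [2 * B]). *)
set (M := d0 + 2 * B + 1).
set (Q := Rabs x0 + 2 * B / eta + 1).
assert (hQ0 : 0 <= 2 * B / eta) by (apply Rdiv_le_0_compat; lra).
pose proof (Rabs_pos x0) as hax0.
assert (hQ : 2 * B < eta * Q ^ 2).
{ assert (2 * B = eta * (2 * B / eta)) by (field; lra).
  assert (2 * B / eta < Q) by (unfold Q; lra).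
  assert (Q <= Q ^ 2) by (unfold Q in *; nra). nra. }
destruct (box_attains_min (fun p => V (fst p) (fst (snd p)) (snd (snd p)))
   (- Q) Q 0 M t1 t2) as [u [v [w [hu [hv [hwt hmin]]]]]].
{ unfold Q. lra. }
{ unfold M. lra. }
{ easy. }
{ intros u v w hu hv hwt. unfold V.
  assert (cu : continuous (fun p : R * (R * R) => fst p) (u, (v, w)))
    by apply continuous_fst.
  assert (cv : continuous (fun p : R * (R * R) => fst (snd p)) (u, (v, w))).
  { apply (continuous_comp snd fst); [apply continuous_snd|apply continuous_fst]. }
  assert (cw : continuous (fun p : R * (R * R) => snd (snd p)) (u, (v, w))).
  { apply (continuous_comp snd snd); apply continuous_snd. }
  assert (cH : forall a, continuous (fun p => H (fst p) (snd p)) (a, w)).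
  { intros a. now apply continuity_2d_pt_filterlim, hcont. }
  repeat apply @continuous_plus; try apply continuous_const.
  - exact cv.
  - apply @continuous_opp.
    apply (continuous_comp_2 (fun p : R * (R * R) => fst p + fst (snd p))
      (fun p => snd (snd p)) H).
    + now apply @continuous_plus.
    + exact cw.
    + apply cH.
  - now apply (continuous_comp_2 (fun p : R * (R * R) => fst p)
      (fun p => snd (snd p)) H).
  - apply (continuous_mult (fun _ => eta)); [apply continuous_const|].
    unfold weight. apply @continuous_mult.
    + apply (continuous_comp (fun p : R * (R * R) => snd (snd p))
        (fun t => exp (K * (t - t1)))); [exact cw|].
      apply (ex_derive_continuous (fun t => exp (K * (t - t1)))). now auto_derive.
    + apply (continuous_comp (fun p : R * (R * R) => fst p)
        (fun x => 1 + x ^ 2)); [exact cu|].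
      apply (ex_derive_continuous (fun x => 1 + x ^ 2)). now auto_derive. }
simpl in hmin.
assert (hVneg : V u v w < 0).
{ eapply Rle_lt_trans; [|exact hV0]. apply hmin.
  - apply Rabs_le_between. unfold Q. lra.
  - unfold M. lra.
  - lra. }
assert (hE : 1 <= exp (K * (w - t1))).
{ rewrite <- exp_0. destruct (Rle_lt_or_eq_dec 0 (K * (w - t1))) as [h|<-].
  - unfold K. nra.
  - now left; apply exp_increasing.
  - lra. }
pose proof (hB' (u + v) w hwt) as hb1. pose proof (hB' u w hwt) as hb2.
pose proof (hw u w) as hwu.
assert (hetaw : 0 < eta * weight u w) by now apply Rmult_lt_0_compat.
(* [V] is positive at zero separation, on the far faces and at the initial time, so the minimum is
   interior in space and later than [t1]. *)
assert (hv0 : 0 < v).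
{ destruct (Rle_lt_or_eq_dec 0 v (proj1 hv)) as [h|h]; [easy|].
  subst v. unfold V in hVneg. rewrite Rplus_0_r in hVneg. lra. }
assert (hvM : v < M).
{ apply Rnot_le_lt. intros h. unfold V, M in *. lra. }
assert (huQ : - Q < u < Q).
{ assert (hsq : u ^ 2 < Q ^ 2).
  { apply Rnot_le_lt. intros h. unfold V, weight in hVneg.
    assert (eta * Q ^ 2 <= eta * (exp (K * (w - t1)) * (1 + u ^ 2))).
    { apply Rmult_le_compat_l; [lra|]. nra. }
    lra. }
  unfold Q in *. split; nra. }
assert (hwt1 : t1 < w).
{ destruct (Rle_lt_or_eq_dec t1 w (proj1 hwt)) as [h|h]; [easy|].
  subst w. unfold V in hVneg. specialize (hinit u v (proj1 hv)). lra. }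
set (E := exp (K * (w - t1))) in *.
assert (eDx : forall x, Derive (fun z => H z w) x = Hx x w)
  by (intros x; now apply is_derive_unique, hdx).
assert (eDxx : forall x, Derive (fun z => Hx z w) x = Hxx x w)
  by (intros x; now apply is_derive_unique, hdxx).
assert (eDt : forall x, Derive (fun z => H x z) w = Ht x w)
  by (intros x; now apply is_derive_unique, hdt).
assert (hmin2 : forall z, 0 <= z <= M -> V u v w <= V u z w).
{ intros z hz. now apply hmin. }
assert (hd2 : forall z, is_derive (fun z => V u z w) z (1 - Hx (u + z) w)).
{ intros z. unfold V. auto_derive.
  - exists (Hx (u + z) w). now apply hdx.
  - rewrite eDx. ring. }
assert (first2 : Hx (u + v) w = 1).
{ pose proof (derive_zero_of_min _ 0 M v _ (conj hv0 hvM) (hd2 v) hmin2). lra. }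
assert (second2 : Hxx (u + v) w <= 0).
{ enough (0 <= - Hxx (u + v) w) by lra.
  apply (second_derive_nonneg_of_min (fun z => V u z w)
    (fun z => 1 - Hx (u + z) w) 0 M v); [easy|easy| |easy].
  auto_derive.
  - exists (Hxx (u + v) w). now apply hdxx.
  - rewrite eDxx. ring. }
(* Varying the left endpoint while the right one [u + v] stays fixed. *)
set (f1 := fun z => V z (u + v - z) w).
set (a1 := Rmax (- Q) (u + v - M)). set (b1 := Rmin Q (u + v)).
assert (hab : a1 < u < b1).
{ split; [apply Rmax_lub_lt; lra|apply Rmin_glb_lt; lra]. }
assert (hmin1 : forall z, a1 <= z <= b1 -> f1 u <= f1 z).
{ intros z [hz1 hz2]. unfold f1. replace (u + v - u) with v by ring.
  pose proof (Rmax_l (- Q) (u + v - M)). pose proof (Rmax_r (- Q) (u + v - M)).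
  pose proof (Rmin_l Q (u + v)). pose proof (Rmin_r Q (u + v)).
  unfold a1 in hz1. unfold b1 in hz2. apply hmin; lra. }
assert (hd1 : forall z, is_derive f1 z (Hx z w - 1 + 2 * eta * E * z)).
{ intros z.
  apply (is_derive_ext (fun z => u + v - z - H (u + v) w + H z w + eps
    + eta * (E * (1 + z ^ 2)))).
  { intros s. unfold f1, V, weight. now replace (s + (u + v - s)) with (u + v) by ring. }
  auto_derive.
  - exists (Hx z w). now apply hdx.
  - rewrite eDx. ring. }
assert (first1 : Hx u w - 1 + 2 * eta * E * u = 0).
{ apply (derive_zero_of_min f1 a1 b1 u); easy. }
assert (second1 : 0 <= Hxx u w + 2 * eta * E).
{ apply (second_derive_nonneg_of_min f1
    (fun z => Hx z w - 1 + 2 * eta * E * z) a1 b1 u); [easy|easy| |easy].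
  auto_derive.
  - exists (Hxx u w). now apply hdxx.
  - rewrite eDxx. ring. }
assert (time : - Ht (u + v) w + Ht u w + eta * (K * E * (1 + u ^ 2)) <= 0).
{ apply (derive_nonpos_of_left_min (fun t => V u v t) t1 w); [easy| |].
  - unfold V, weight. auto_derive.
    + split; [exists (Ht (u + v) w); now apply hdt|].
      split; [exists (Ht u w); now apply hdt|easy].
    + rewrite !eDt.
      unfold E, Rminus. simpl. ring.
  - intros z hz. apply hmin; lra. }
assert (hord : H u w < H (u + v) w) by (unfold V in hVneg; lra).
specialize (hpde u v w hwt hv0 hord first2 second2).
assert (hetaE : 0 < eta * E) by (apply Rmult_lt_0_compat; lra).
assert (hmax : Rmax 0 (- Hxx u w) <= 2 * (eta * E)) by (apply Rmax_lub; lra).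
(* By [first1], [1 - Hx u w] is linear in [u]; [2 |u| <= 1 + u^2] lets the quadratic weight absorb
   it. *)
assert (habs : L * Rabs (1 - Hx u w) <= eta * E * (L * (1 + u ^ 2))).
{ replace (1 - Hx u w) with (2 * (eta * E) * u) by lra.
  rewrite Rabs_mult, (Rabs_pos_eq (2 * _)) by lra.
  assert (2 * Rabs u <= 1 + u ^ 2).
  { rewrite <- (pow2_abs u). pose proof (pow2_ge_0 (Rabs u - 1)). lra. }
  assert (0 <= eta * E * L) by (apply Rmult_le_pos; lra). nra. }
assert (0 <= eta * E * u ^ 2) by (apply Rmult_le_pos; [lra|apply pow2_ge_0]).
unfold K in time. lra.
Qed.

(** * The barrier along a solution *)

(** The horizontal position [E(v, t - t0)] of the comparison curve at the height [v = y x t]. *)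
Definition barrier (y : R -> R -> R) (t0 x t : R) : R :=
  sqrt (t - t0) * profile (y x t / sqrt (t - t0)).

Lemma is_derive_barrier_space (y : R -> R -> R) (t0 x t p : R) :
  t0 < t -> 0 < y x t -> is_derive (fun z => y z t) x p ->
  is_derive (fun z => barrier y t0 z t) x
    (profile1 (y x t / sqrt (t - t0)) * p).
Proof.
intros ht hy hd.
assert (hr : 0 < sqrt (t - t0)) by (apply sqrt_lt_R0; lra).
assert (hs : 0 <= y x t / sqrt (t - t0)) by (apply Rdiv_le_0_compat; lra).
unfold barrier. auto_derive.
- split; [eexists; now apply is_derive_profile|].
  split; [now exists p|easy].
- assert (e1 : Derive (fun z => y z t) x = p) by now apply is_derive_unique.
  pose proof (is_derive_unique _ _ _ (is_derive_profile _ hs)) as e2.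
  rewrite e1. change (fun x0 => profile x0) with profile.
  unfold Rdiv in *. rewrite e2. field. lra.
Qed.

Lemma is_derive_barrier_space2 (y q : R -> R -> R) (t0 x t m : R) :
  t0 < t -> 0 < y x t -> is_derive (fun z => y z t) x (q x t) ->
  is_derive (fun z => q z t) x m ->
  is_derive (fun z => profile1 (y z t / sqrt (t - t0)) * q z t) x
    (profile2 (y x t / sqrt (t - t0)) * q x t ^ 2 / sqrt (t - t0)
     + profile1 (y x t / sqrt (t - t0)) * m).
Proof.
intros ht hy hd hd2.
assert (hr : 0 < sqrt (t - t0)) by (apply sqrt_lt_R0; lra).
assert (hs : 0 <= y x t / sqrt (t - t0)) by (apply Rdiv_le_0_compat; lra).
auto_derive.
- split; [eexists; now apply is_derive_profile1|].
  split; [now exists (q x t)|]. split; [now exists m|easy].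
- assert (e1 : Derive (fun z => y z t) x = q x t) by now apply is_derive_unique.
  assert (e3 : Derive (fun z => q z t) x = m) by now apply is_derive_unique.
  pose proof (is_derive_unique _ _ _ (is_derive_profile1 _ hs)) as e2.
  rewrite e1, e3. change (fun x0 => profile1 x0) with profile1.
  unfold Rdiv in *. rewrite e2. field. lra.
Qed.

Lemma is_derive_barrier_time (y : R -> R -> R) (t0 x t m : R) :
  t0 < t -> 0 < y x t -> is_derive (fun z => y x z) t m ->
  is_derive (fun z => barrier y t0 x z) t
    ((profile (y x t / sqrt (t - t0))
      - y x t / sqrt (t - t0) * profile1 (y x t / sqrt (t - t0)))
     / (2 * sqrt (t - t0))
     + profile1 (y x t / sqrt (t - t0)) * m).
Proof.
intros ht hy hd.
assert (hr : 0 < sqrt (t - t0)) by (apply sqrt_lt_R0; lra).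
assert (hs : 0 <= y x t / sqrt (t - t0)) by (apply Rdiv_le_0_compat; lra).
unfold barrier. auto_derive.
- split; [lra|]. split; [eexists; now apply is_derive_profile|].
  split; [now exists m|]. split; [lra|]. split; [|easy]. unfold Rminus in hr. lra.
- assert (e1 : Derive (fun z => y x z) t = m) by now apply is_derive_unique.
  pose proof (is_derive_unique _ _ _ (is_derive_profile _ hs)) as e2.
  rewrite e1. change (fun x0 => profile x0) with profile.
  unfold Rdiv, Rminus in *. rewrite e2. field. lra.
Qed.

Lemma continuity_2d_barrier (y : R -> R -> R) (t0 x t : R) :
  t0 < t -> 0 < y x t -> continuity_2d_pt y x t ->
  continuity_2d_pt (barrier y t0) x t.
Proof.
intros ht hy hc. apply continuity_2d_pt_filterlim in hc.
assert (hr : 0 < sqrt (t - t0)) by (apply sqrt_lt_R0; lra).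
assert (hs : 0 <= y x t / sqrt (t - t0)) by (apply Rdiv_le_0_compat; lra).
assert (ct : forall g : R -> R, ex_derive g t ->
  continuous (fun p : R * R => g (snd p)) (x, t)).
{ intros g hg. apply (continuous_comp snd g); [apply continuous_snd|].
  now apply (ex_derive_continuous g). }
apply continuity_2d_pt_filterlim. unfold barrier.
apply (continuous_mult (fun p : R * R => sqrt (snd p - t0))
  (fun p => profile (y (fst p) (snd p) / sqrt (snd p - t0)))).
- apply (ct (fun s => sqrt (s - t0))). auto_derive. lra.
- apply (continuous_comp (fun p : R * R => y (fst p) (snd p) / sqrt (snd p - t0))
    profile).
  + apply (continuous_mult (fun p : R * R => y (fst p) (snd p))
      (fun p => / sqrt (snd p - t0))); [exact hc|].
    apply (ct (fun s => / sqrt (s - t0))). auto_derive.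
    split; [lra|]. split; [unfold Rminus in hr; lra|easy].
  + apply (ex_derive_continuous profile). eexists. now apply is_derive_profile.
Qed.

(** This gives both the uniform bound for the maximum principle and, as [t] tends to [t0], its
    initial condition. *)
Lemma barrier_abs_le (y : R -> R -> R) (t0 x t : R) :
  t0 < t -> 0 < y x t -> - sqrt (t - t0) <= barrier y t0 x t <= 0.
Proof.
intros ht hy.
assert (hr : 0 < sqrt (t - t0)) by (apply sqrt_lt_R0; lra).
assert (hs : 0 <= y x t / sqrt (t - t0)) by (apply Rdiv_le_0_compat; lra).
pose proof (profile_bounds _ hs). unfold barrier. nra.
Qed.

(* Left: [H_t] for [H = barrier y t0], with [p = y_x] and [m = y_xx].  The last term
   carries the factor [1 - H_x], which is why it acts only as a drift for [x - H]. *)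
Lemma barrier_evolution (r s p m : R) :
  0 < r ->
  (profile s - s * profile1 s) / (2 * r) + profile1 s * (m / (1 + p ^ 2)) =
  - defect s / r + (profile2 s * p ^ 2 / r + profile1 s * m) / (1 + p ^ 2)
  + profile2 s / r * ((1 + profile1 s * p)
      / ((1 + profile1 s ^ 2) * (1 + p ^ 2))) * (1 - profile1 s * p).
Proof. intros hr. unfold defect. field. repeat split; nra. Qed.

(** As [2 |a b| <= a^2 + b^2], the drift coefficient in [barrier_evolution] stays bounded however
    steep the solution is. *)
Lemma cross_ratio_bound (a b : R) :
  Rabs ((1 + a * b) / ((1 + a ^ 2) * (1 + b ^ 2))) <= 2.
Proof.
assert (h : 1 <= (1 + a ^ 2) * (1 + b ^ 2)) by nra.
apply Rabs_le. split.
- apply Rle_div_r; [lra|]. nra.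
- apply Rle_div_l; [lra|]. nra.
Qed.

(** * Slope bound by comparison *)

Lemma slope_bound_shifted (T : R) (y p m : R -> R -> R) :
  (forall x t, 0 < t < T -> 0 < y x t) ->
  (forall x t, 0 < t < T -> continuity_2d_pt y x t) ->
  (forall x t, 0 < t < T -> is_derive (fun z => y z t) x (p x t)) ->
  (forall x t, 0 < t < T -> is_derive (fun z => p z t) x (m x t)) ->
  (forall x t, 0 < t < T ->
     is_derive (fun z => y x z) t (m x t / (1 + p x t ^ 2))) ->
  forall t0 x t, 0 < t0 < t -> t < T ->
    profile1 (y x t / sqrt (t - t0)) * p x t <= 1.
Proof.
intros hpos hcont hdx hdxx hdt t0 x t h0 hT.
assert (main : forall eps, 0 < eps -> forall z d, 0 <= d ->
  barrier y t0 (z + d) t - barrier y t0 z t <= d + eps).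
{ intros eps heps.
  (* Starting within [eps^2] of [t0] keeps the barrier between [- eps] and 0, which is the initial
     condition up to [eps]. *)
  set (h := Rmin (eps ^ 2) (t - t0)).
  assert (hh : 0 < h) by (apply Rmin_pos; nra).
  assert (hh1 : h <= eps ^ 2) by apply Rmin_l.
  assert (hh2 : h <= t - t0) by apply Rmin_r.
  set (t1 := t0 + h).
  assert (ht1 : t0 < t1 <= t) by (unfold t1; lra).
  assert (hr1 : 0 < sqrt (t1 - t0)) by (apply sqrt_lt_R0; lra).
  assert (hsq : sqrt (t1 - t0) <= eps).
  { rewrite <- (sqrt_pow2 eps) by lra. apply sqrt_le_1_alt. unfold t1. lra. }
  apply (two_point_maximum_principle (barrier y t0)
    (fun z s => profile1 (y z s / sqrt (s - t0)) * p z s)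
    (fun z s => profile2 (y z s / sqrt (s - t0)) * p z s ^ 2 / sqrt (s - t0)
       + profile1 (y z s / sqrt (s - t0)) * m z s)
    (fun z s => (profile (y z s / sqrt (s - t0))
       - y z s / sqrt (s - t0) * profile1 (y z s / sqrt (s - t0)))
       / (2 * sqrt (s - t0))
       + profile1 (y z s / sqrt (s - t0)) * (m z s / (1 + p z s ^ 2)))
    (* [L] bounds the drift: [Rabs (profile2 s) <= 1], the cross ratio is at most 2, and
       [sqrt (s - t0) >= sqrt (t1 - t0)]. *)
    t1 t (sqrt (t - t0)) (2 / sqrt (t1 - t0)) eps).
  - lra.
  - apply Rdiv_le_0_compat; lra.
  - lra.
  - intros z s hs.
    assert (sqrt (s - t0) <= sqrt (t - t0)) by (apply sqrt_le_1_alt; lra).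
    destruct (barrier_abs_le y t0 z s ltac:(lra) (hpos z s ltac:(lra))).
    apply Rabs_le. pose proof (sqrt_pos (t - t0)). lra.
  - intros z s hs. apply continuity_2d_barrier; [lra|apply hpos; lra|].
    apply hcont. lra.
  - intros z s hs. apply is_derive_barrier_space; [lra|apply hpos; lra|].
    apply hdx. lra.
  - intros z s hs.
    apply is_derive_barrier_space2; [lra|apply hpos; lra|apply hdx|apply hdxx]; lra.
  - intros z s hs. apply is_derive_barrier_time; [lra|apply hpos; lra|].
    apply hdt. lra.
  - intros z d hd.
    pose proof (barrier_abs_le y t0 z t1 ltac:(lra) (hpos z t1 ltac:(lra))).
    pose proof (barrier_abs_le y t0 (z + d) t1 ltac:(lra) (hpos (z + d) t1 ltac:(lra))).
    lra.
  - intros z d s hs hd hord first second.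
    assert (hr : 0 < sqrt (s - t0)) by (apply sqrt_lt_R0; lra).
    set (r := sqrt (s - t0)) in *.
    assert (hy1 : 0 < y z s) by (apply hpos; lra).
    assert (hy2 : 0 < y (z + d) s) by (apply hpos; lra).
    rewrite !barrier_evolution by easy.
    unfold barrier in hord. fold r in hord.
    set (s1 := y z s / r) in *. set (s2 := y (z + d) s / r) in *.
    assert (hs1 : 0 <= s1) by (apply Rdiv_le_0_compat; lra).
    assert (hs2 : 0 <= s2) by (apply Rdiv_le_0_compat; lra).
    (* The ordering of the barrier values passes to the heights because [profile] increases;
       monotonicity of [defect] then gives the defect terms the favourable sign. *)
    assert (h12 : s1 <= s2).
    { apply Rnot_lt_le. intros hlt.
      pose proof (profile_increasing s2 s1 hs2 ltac:(lra)). nra. }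
    assert (hdef : defect s1 / r <= defect s2 / r).
    { apply Rmult_le_compat_r; [now apply Rlt_le, Rinv_0_lt_compat|].
      now apply defect_increasing. }
    set (H2 := profile2 s2 * p (z + d) s ^ 2 / r + profile1 s2 * m (z + d) s) in *.
    set (H1 := profile2 s1 * p z s ^ 2 / r + profile1 s1 * m z s) in *.
    assert (hin : forall q, 0 < / (1 + q ^ 2) <= 1).
    { intros q. pose proof (pow2_ge_0 q). split.
      - apply Rinv_0_lt_compat. lra.
      - rewrite <- Rinv_1. apply Rinv_le_contravar; lra. }
    assert (diff2 : H2 / (1 + p (z + d) s ^ 2) <= 0).
    { unfold Rdiv. specialize (hin (p (z + d) s)). nra. }
    assert (diff1 : - Rmax 0 (- H1) <= H1 / (1 + p z s ^ 2)).
    { unfold Rdiv. specialize (hin (p z s)).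
      pose proof (Rmax_l 0 (- H1)). pose proof (Rmax_r 0 (- H1)). nra. }
    (* At the right endpoint [H_x = 1], so its drift term vanishes; only the one at the left
       endpoint has to be bounded. *)
    rewrite first.
    set (ratio := (1 + profile1 s1 * p z s)
      / ((1 + profile1 s1 ^ 2) * (1 + p z s ^ 2))).
    assert (drift : Rabs (profile2 s1 / r * ratio * (1 - profile1 s1 * p z s))
      <= 2 / sqrt (t1 - t0) * Rabs (1 - profile1 s1 * p z s)).
    { rewrite Rabs_mult. apply Rmult_le_compat_r; [apply Rabs_pos|].
      rewrite Rabs_mult. replace (2 / sqrt (t1 - t0)) with (/ sqrt (t1 - t0) * 2)
        by (field; lra).
      apply Rmult_le_compat; try apply Rabs_pos; [|apply cross_ratio_bound].
      unfold Rdiv. rewrite Rabs_mult, (Rabs_pos_eq (/ r))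
        by now apply Rlt_le, Rinv_0_lt_compat.
      rewrite <- (Rmult_1_l (/ sqrt (t1 - t0))).
      apply Rmult_le_compat; [apply Rabs_pos|now apply Rlt_le, Rinv_0_lt_compat| |].
      - pose proof (profile2_bounds s1 hs1). pose proof (gauss_le_1 s1).
        unfold amp in *. lra.
      - apply Rinv_le_contravar; [easy|]. apply sqrt_le_1_alt. lra. }
    apply Rabs_le_between in drift.
    replace (1 - 1) with 0 by ring. rewrite Rmult_0_r. unfold Rdiv in *. lra. }
assert (hy : 0 < y x t) by (apply hpos; lra).
(* With [eps] arbitrary, [main] says that [barrier - z] is nonincreasing in [z], so [x] is a minimum
   from the left. *)
enough (profile1 (y x t / sqrt (t - t0)) * p x t - 1 <= 0) by lra.
apply (derive_nonpos_of_left_min (fun z => barrier y t0 z t - z) (x - 1) x);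
  [lra| |].
- apply @is_derive_minus; [|now auto_derive].
  apply is_derive_barrier_space; [lra|easy|]. apply hdx. lra.
- intros z hz. apply Rnot_lt_le. intros hlt.
  set (e := (barrier y t0 x t - x - (barrier y t0 z t - z)) / 2).
  pose proof (main e ltac:(unfold e; lra) z (x - z) ltac:(lra)) as hm.
  replace (z + (x - z)) with x in hm by ring. unfold e in hm. lra.
Qed.

(** The shifted bound is continuous in [t0] at 0, so a violation at [t0 = 0] would persist for some
    small [t0 > 0]. *)
Lemma slope_bound (T : R) (y p m : R -> R -> R) :
  (forall x t, 0 < t < T -> 0 < y x t) ->
  (forall x t, 0 < t < T -> continuity_2d_pt y x t) ->
  (forall x t, 0 < t < T -> is_derive (fun z => y z t) x (p x t)) ->
  (forall x t, 0 < t < T -> is_derive (fun z => p z t) x (m x t)) ->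
  (forall x t, 0 < t < T ->
     is_derive (fun z => y x z) t (m x t / (1 + p x t ^ 2))) ->
  forall x t, 0 < t < T -> profile1 (y x t / sqrt t) * p x t <= 1.
Proof.
intros hpos hcont hdx hdxx hdt x t ht.
assert (hy : 0 < y x t) by now apply hpos.
assert (hr : 0 < sqrt (t - 0)) by (apply sqrt_lt_R0; lra).
assert (hs : 0 <= y x t / sqrt (t - 0)) by (apply Rdiv_le_0_compat; lra).
apply Rnot_lt_le. intros hlt.
assert (hc : continuous (fun t0 => profile1 (y x t / sqrt (t - t0)) * p x t) 0).
{ apply (ex_derive_continuous (fun t0 => profile1 (y x t / sqrt (t - t0)) * p x t)).
  auto_derive. split; [eexists; now apply is_derive_profile1|].
  split; [lra|]. split; [unfold Rminus in hr; lra|easy]. }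
destruct (hc (fun v => 1 < v)) as [d hd].
{ apply (open_gt 1). now rewrite Rminus_0_r. }
set (t0 := Rmin (d / 2) (t / 2)).
pose proof (cond_pos d).
assert (0 < t0) by (apply Rmin_pos; lra).
assert (t0 <= d / 2) by apply Rmin_l. assert (t0 <= t / 2) by apply Rmin_r.
assert (hb : 1 < profile1 (y x t / sqrt (t - t0)) * p x t).
{ apply hd. change (Rabs (t0 - 0) < d). rewrite Rabs_pos_eq; lra. }
pose proof (slope_bound_shifted T y p m hpos hcont hdx hdxx hdt t0 x t
  ltac:(lra) ltac:(lra)). lra.
Qed.

(** * Explicit form of the estimate *)

(** The lower bound on [slope_weight] and [amp = 1/100000] give [p <= 200000 (1 + s) g] with
    [g = exp (s^2/4)]. The lone [g] is at most [3 + s g]: it is at most 3 for [s < 1] and at most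
    [s g] otherwise. Hence [600000 = 3 * 200000]. *)
Lemma inv_profile1_bound (s p : R) :
  0 <= s -> profile1 s * p <= 1 ->
  p <= 600000 * s * exp (s ^ 2 / 4) + 600000.
Proof.
intros hs h.
set (g := exp (s ^ 2 / 4)).
assert (hg : gauss s * g = 1).
{ unfold gauss, g. rewrite <- exp_plus, <- exp_0. f_equal. ring. }
assert (hg0 : 0 < g) by apply exp_pos.
assert (hlow : 1 <= 200000 * (1 + s) * g * profile1 s).
{ unfold profile1.
  replace (200000 * (1 + s) * g * (amp * gauss s * slope_weight s))
    with (gauss s * g * (200000 * amp) * ((1 + s) * slope_weight s)) by ring.
  rewrite hg. unfold amp.
  pose proof (slope_weight_lower s hs) as hk.
  apply (Rmult_le_compat_l (1 + s)) in hk; [|lra].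
  replace ((1 + s) * (/ 2 * / (1 + s))) with (/ 2) in hk by (field; lra). lra. }
assert (hbound : p <= 200000 * (1 + s) * g).
{ destruct (profile1_bounds s hs) as [hp _].
  apply (Rmult_le_reg_l (profile1 s)); [easy|]. lra. }
assert (hg3 : g <= 3 + s * g).
{ destruct (Rle_lt_dec 1 s) as [h1|h1]; [nra|].
  assert (g <= 3).
  { eapply Rle_trans; [|apply exp_le_3]. left. apply exp_increasing. nra. }
  nra. }
assert (0 <= s * g) by (apply Rmult_le_pos; lra).
lra.
Qed.

Theorem corollary1p4 :
  exists C1 : R,
    forall (T : R) (y : R -> R -> R),
      0 < T ->
      graphical_csf T y ->
      (forall x t : R, 0 < t < T -> 0 < y x t) ->
      forall x t : R, 0 < t < T ->
        Rabs (partial_derive 1 0 y x t) <=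
        C1 * sqrt ((y x t) ^ 2 / t) * exp ((y x t) ^ 2 / (4 * t)) + C1.
Proof.
exists 600000. intros T y hT [hsmooth hflow] hpos x t ht.
assert (hcont : forall x t, 0 < t < T -> continuity_2d_pt y x t).
{ intros a s hs. exact (proj1 (hsmooth a s hs 0%nat)). }
assert (hdx : forall x t, 0 < t < T ->
  is_derive (fun z => y z t) x (partial_derive 1 0 y x t)).
{ intros a s hs. apply (Derive_correct (fun z => y z s)).
  exact (ex_diff_n_ex_deriv_inf_1 1 0 0 (le_n _) y a s (hsmooth a s hs _)). }
assert (hdxx : forall x t, 0 < t < T ->
  is_derive (fun z => partial_derive 1 0 y z t) x (partial_derive 2 0 y x t)).
{ intros a s hs. apply (Derive_correct (fun z => partial_derive 1 0 y z s)).
  exact (ex_diff_n_ex_deriv_inf_1 2 1 0 (le_n _) y a s (hsmooth a s hs _)). }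
assert (hdt : forall x t, 0 < t < T -> is_derive (fun z => y x z) t
  (partial_derive 2 0 y x t / (1 + partial_derive 1 0 y x t ^ 2))).
{ intros a s hs. rewrite <- hflow by easy. apply (Derive_correct (fun z => y a z)).
  exact (ex_diff_n_ex_deriv_inf_2 1 0 0 (le_n _) y a s (hsmooth a s hs _)). }
assert (hr : 0 < sqrt t) by (apply sqrt_lt_R0; lra).
assert (hy : 0 < y x t) by now apply hpos.
assert (hs : 0 <= y x t / sqrt t) by (apply Rdiv_le_0_compat; lra).
assert (hsq : (y x t / sqrt t) ^ 2 = y x t ^ 2 / t).
{ unfold Rdiv. rewrite Rpow_mult_distr, pow_inv, pow2_sqrt; [easy|lra]. }
replace (y x t ^ 2 / (4 * t)) with ((y x t / sqrt t) ^ 2 / 4)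
  by (rewrite hsq; field; lra).
rewrite <- hsq, sqrt_pow2 by easy.
assert (hright : partial_derive 1 0 y x t <=
  600000 * (y x t / sqrt t) * exp ((y x t / sqrt t) ^ 2 / 4) + 600000).
{ apply inv_profile1_bound; [easy|].
  now apply (slope_bound T y _ (partial_derive 2 0 y)). }
(* The flow is invariant under [x -> - x], so the upper bound for the reflected solution is the
   lower bound for [y_x]. *)
assert (hleft : - partial_derive 1 0 y x t <=
  600000 * (y x t / sqrt t) * exp ((y x t / sqrt t) ^ 2 / 4) + 600000).
{ apply inv_profile1_bound; [easy|].
  rewrite <- (Ropp_involutive x).
  apply (slope_bound T (fun z s => y (- z) s)
    (fun z s => - partial_derive 1 0 y (- z) s)
    (fun z s => partial_derive 2 0 y (- z) s)).
  - intros a s h. now apply hpos.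
  - intros a s h. apply continuity_2d_pt_filterlim.
    apply (continuous_comp_2 (fun q : R * R => - fst q) snd y).
    + apply @continuous_opp, continuous_fst.
    + apply continuous_snd.
    + now apply continuity_2d_pt_filterlim, hcont.
  - intros a s h. apply (is_derive_reflect (fun z => y z s)). now apply hdx.
  - intros a s h. rewrite <- (Ropp_involutive (partial_derive 2 0 y (- a) s)).
    apply @is_derive_opp, (is_derive_reflect (fun z => partial_derive 1 0 y z s)).
    now apply hdxx.
  - intros a s h.
    replace ((- partial_derive 1 0 y (- a) s) ^ 2)
      with (partial_derive 1 0 y (- a) s ^ 2) by ring.
    now apply hdt.
  - easy. }
apply Rabs_le. lra.
Qed.
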